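(* Let $\diamond$ be one of the binary operations quotient ($\div$) or remainder ($\bmod$). Then there exist, for each positive integer $m$, a finite ground set $U_m$ with $|U_m|=O(m)$, a total order $<_m$ on $U_m$, and families $\mathcal{F}_m,\mathcal{G}_m$ of subsets of $U_m$ such that $Z_{<_m}(\mathcal{F}_m)+Z_{<_m}(\mathcal{G}_m)=O(m^3)$ and $Z_{<_m}(\mathcal{F}_m\diamond\mathcal{G}_m)=\Omega(2^{m/5}/\mathrm{poly}(m))$, i.e. $Z_{<_m}(\mathcal{F}_m\diamond\mathcal{G}_m)\ge 2^{m/5}/p(m)$ for some polynomial $p$ and all sufficiently large $m$.
   Context: A family of sets is a set of subsets of a finite ground set $U$. Join: $\mathcal{F}\sqcup\mathcal{G}=\{F\cup G\mid F\in\mathcal{F},G\in\mathcal{G}\}$. Quotient: $\mathcal{F}\div\mathcal{G}=\{S\mid \forall G\in\mathcal{G}: S\cup G\in\mathcal{F}\wedge S\cap G=\emptyset\}$. Remainder: $\mathcal{F}\bmod\mathcal{G}=\mathcal{F}\setminus(\mathcal{G}\sqcup(\mathcal{F}\div\mathcal{G}))$. A zero-suppressed binary decision diagram (ZDD) with respect to a total order $<$ on $U$ is a rooted DAG with two terminal nodes $\top,\bot$ and internal nodes $\mathtt{n}$, each with a label $\mathsf{lb}(\mathtt{n})\in U$ and children $\mathsf{lo}(\mathtt{n}),\mathsf{hi}(\mathtt{n})$, labels strictly increasing along arcs. A node represents: $\{\emptyset\}$ if $\top$, $\emptyset$ if $\bot$, and $\mathcal{F}_{\mathsf{lo}(\mathtt{n})}\cup\{\{\mathsf{lb}(\mathtt{n})\}\cup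 S\mid S\in\mathcal{F}_{\mathsf{hi}(\mathtt{n})}\}$ otherwise; the ZDD represents the family of its root. The reduced ZDD (obtained by merging nodes with identical label and children and deleting nodes whose hi-child is $\bot$) is the unique smallest ZDD for the family and order; $Z_<(\mathcal{F})$ is its number of nodes. Asymptotics are as $m\to\infty$. *)

(* Defs.v *)
From mathcomp Require Import boolp.
From mathcomp Require Import all_boot all_order.

Set Implicit Arguments.
Unset Strict Implicit.
Unset Printing Implicit Defensive.

Import Order.TTheory.

Section Families.
Variable U : finType.
Implicit Types F G : {set {set U}}.

Definition fam_join F G : {set {set U}} := [set A :|: B | A in F, B in G].

Definition fam_quo F G : {set {set U}} :=
  [set S | [forall B in G, (S :|: B \in F) && (S :&: B == set0)]].

Definition fam_rem F G : {set {set U}} := F :\: fam_join G (fam_quo F G).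

End Families.

Variant fam_op := Quotient | Remainder.

Definition fam_op_fun (op : fam_op) (U : finType) :
    {set {set U}} -> {set {set U}} -> {set {set U}} :=
  match op with
  | Quotient => @fam_quo U
  | Remainder => @fam_rem U
  end.

(* A vertex is [inl n] for an internal node [n], [inr true] for the terminal
   ⊤ and [inr false] for the terminal ⊥. *)
Definition zdd_arc (N : finType) (lo hi : N -> N + bool) : rel (N + bool) :=
  fun v w => if v is inl n then (w == lo n) || (w == hi n) else false.

(* [zdd_ordered] makes the graph acyclic. *)
Record zdd (d : Order.disp_t) (U : finOrderType d) := Zdd {
  zdd_node : finType;
  zdd_root : zdd_node + bool;
  zdd_lb : zdd_node -> U;
  zdd_lo : zdd_node -> zdd_node + bool;
  zdd_hi : zdd_node -> zdd_node + bool;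
  zdd_ordered : forall n n', zdd_arc zdd_lo zdd_hi (inl n) (inl n') ->
    (zdd_lb n < zdd_lb n')%O;
  zdd_rooted : forall n, connect (zdd_arc zdd_lo zdd_hi) zdd_root (inl n)
}.

Section Zdd.
Variables (d : Order.disp_t) (U : finOrderType d).
Implicit Types (D : zdd U) (S : {set U}) (F A B : {set {set U}}) (x y : U).

(* Membership of a set in the family represented by a vertex; the defining
   equations of that family are [zdd_fam_top], [zdd_fam_bot] and
   [zdd_fam_node] below. *)
Inductive zdd_mem D : zdd_node D + bool -> {set U} -> Prop :=
| zdd_mem_top : zdd_mem (inr true) set0
| zdd_mem_lo n S : zdd_mem (zdd_lo n) S -> zdd_mem (inl n) S
| zdd_mem_hi n S : zdd_mem (zdd_hi n) S -> zdd_mem (inl n) (zdd_lb n |: S).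

Definition zdd_fam D (v : zdd_node D + bool) : {set {set U}} :=
  [set S | `[< zdd_mem v S >]].

Definition zdd_represents D F : Prop := zdd_fam (zdd_root D) = F.

(* Both terminals are counted. *)
Definition zdd_size D : nat := #|zdd_node D|.+2.

Definition zdd_reduced D : Prop :=
  (forall n n' : zdd_node D, zdd_lb n = zdd_lb n' -> zdd_lo n = zdd_lo n' ->
     zdd_hi n = zdd_hi n' -> n = n')
  /\ (forall n : zdd_node D, zdd_hi n <> inr false).

Lemma zdd_fam_top D : zdd_fam (inr true : zdd_node D + bool) = [set set0].
Proof.
apply/setP=> S; rewrite !inE; apply/asboolP/eqP => [H|->]; last by constructor.
by inversion H.
Qed.

Lemma zdd_fam_bot D : zdd_fam (inr false : zdd_node D + bool) = set0.
Proof. by apply/setP=> S; rewrite !inE; apply/asboolP => H; inversion H. Qed.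

Lemma zdd_fam_node D (n : zdd_node D) :
  zdd_fam (inl n) =
  zdd_fam (zdd_lo n) :|: [set zdd_lb n |: S | S in zdd_fam (zdd_hi n)].
Proof.
apply/setP=> S; rewrite !inE; apply/asboolP/orP => [H|[/asboolP|/imsetP[T]]].
- inversion H; subst; first by left; apply/asboolP.
  by right; apply/imsetP; exists S0 => //; rewrite inE; apply/asboolP.
- exact: zdd_mem_lo.
- by rewrite inE => /asboolP HT ->; apply: zdd_mem_hi.
Qed.

Let fam0 x A := [set S in A | x \notin S].
Let fam1 x A := [set S :\ x | S in [set T in A | x \in T]].
Let top A x := (x \in cover A) && [forall y in cover A, (x <= y)%O].
Let step : rel {set {set U}} := fun A B =>
  [exists x, top A x && ((B == fam0 x A) || (B == fam1 x A))].

Let top_ex A : cover A != set0 -> exists x, top A x.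
Proof.
case/set0Pn=> x0 x0A; case: (@arg_minP _ U _ x0 (mem (cover A)) id x0A) => x xA xle.
by exists x; apply/andP; split=> //; apply/forall_inP => y; apply: xle.
Qed.

Let top_uniq A x y : top A x -> top A y -> x = y.
Proof.
case/andP=> xA /forall_inP xle /andP[yA /forall_inP yle].
by apply/eqP; rewrite eq_le xle ?yle.
Qed.

Let famE x A : A = fam0 x A :|: [set x |: S | S in fam1 x A].
Proof.
apply/setP=> S; rewrite !inE; apply/idP/orP => [SA|[/andP[]//|]].
  case xS: (x \in S); last by left; rewrite SA.
  right; apply/imsetP; exists (S :\ x); last by rewrite setD1K.
  by apply/imsetP; exists S => //; rewrite inE SA.
by case/imsetP=> T /imsetP[V]; rewrite inE => /andP[VA xV] -> ->; rewrite setD1K.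
Qed.

Let fam1_n0 x A : x \in cover A -> fam1 x A != set0.
Proof.
case/bigcupP=> S SA xS; apply/set0Pn; exists (S :\ x).
by apply/imsetP; exists S => //; rewrite inE SA.
Qed.

Let lt_cof A B x y : top A x -> (B == fam0 x A) || (B == fam1 x A) ->
  y \in cover B -> (x < y)%O.
Proof.
case/andP=> _ /forall_inP xle H /bigcupP[S SB yS].
have [yA yx]: y \in cover A /\ y != x.
  case/orP: H SB => /eqP->.
    rewrite inE => /andP[SA xS]; split; first by apply/bigcupP; exists S.
    by apply: contraNneq xS => <-.
  case/imsetP=> T; rewrite inE => /andP[TA _] ES; move: yS.
  by rewrite ES !inE => /andP[-> yT]; split=> //; apply/bigcupP; exists T.
by rewrite lt_neqAle eq_sym yx xle.
Qed.

Let cover_eq0 A : cover A = set0 -> A = set0 \/ A = [set set0].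
Proof.
move=> cA; have A0 S : S \in A -> S = set0.
  by move=> SA; apply/eqP; rewrite -subset0 -cA; apply: bigcup_sup.
case: (boolP (set0 \in A)) => H; [right|left]; apply/setP=> S; rewrite !inE.
  by apply/idP/eqP => [/A0|->].
by apply/negP => SA; move: H; rewrite -(A0 _ SA) SA.
Qed.

Let zdd_ind_vertex D (P : zdd_node D + bool -> Prop) :
  (forall b, P (inr b)) ->
  (forall n, P (zdd_lo n) -> P (zdd_hi n) -> P (inl n)) -> forall v, P v.
Proof.
move=> Pb Pn [n|//].
have [k] := ubnP #|[set y | (zdd_lb n < y)%O]|.
elim: k n => // k IH n; rewrite ltnS => nk.
suff Pc w : zdd_arc (@zdd_lo _ _ D) (@zdd_hi _ _ D) (inl n) w -> P w.
  by apply: Pn; apply: Pc; rewrite /= eqxx ?orbT.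
case: w => // n' /zdd_ordered ltn; apply: IH; apply: leq_trans nk.
apply/proper_card/properP; split; last by exists (zdd_lb n'); rewrite !inE ?ltxx.
by apply/subsetP=> y; rewrite !inE; apply: lt_trans.
Qed.

Let zdd_lb_le D v : forall S y, S \in zdd_fam v -> y \in S ->
  if v is inl n then (@zdd_lb _ _ D n <= y)%O else true.
Proof.
elim/zdd_ind_vertex: v => // n IHlo IHhi S y.
have ltc w : zdd_arc (@zdd_lo _ _ D) (@zdd_hi _ _ D) (inl n) w ->
  (if w is inl n' then (zdd_lb n' <= y)%O else true) ->
  if w is inl n' then (zdd_lb n <= y)%O else true.
  by case: w => // n' /zdd_ordered /ltW; apply: le_trans.
rewrite zdd_fam_node => /setUP[Slo yS|/imsetP[T Thi ->]].
  have := IHlo _ _ Slo yS; have := ltc (zdd_lo n).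
  rewrite /= eqxx => /(_ isT) H /H; move: Slo.
  case: (zdd_lo n) => // -[]; last by rewrite zdd_fam_bot inE.
  by rewrite zdd_fam_top inE => /eqP S0; rewrite S0 inE in yS.
case/setU1P=> [->//|yT].
have := IHhi _ _ Thi yT; have := ltc (zdd_hi n).
rewrite /= eqxx orbT => /(_ isT) H /H; move: Thi.
case: (zdd_hi n) => // -[]; last by rewrite zdd_fam_bot inE.
by rewrite zdd_fam_top inE => /eqP S0; rewrite S0 inE in yT.
Qed.

Let zdd_lb_lt D (n : zdd_node D) v S y :
  zdd_arc (@zdd_lo _ _ D) (@zdd_hi _ _ D) (inl n) v ->
  S \in zdd_fam v -> y \in S -> (zdd_lb n < y)%O.
Proof.
case: v => [n' /zdd_ordered lt_n SF yS|[] _].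
- exact: lt_le_trans lt_n (zdd_lb_le SF yS).
- by rewrite zdd_fam_top inE => /eqP->; rewrite inE.
- by rewrite zdd_fam_bot inE.
Qed.

Let zdd_cof D (n : zdd_node D) :
  zdd_fam (zdd_lo n) = fam0 (zdd_lb n) (zdd_fam (inl n)) /\
  zdd_fam (zdd_hi n) = fam1 (zdd_lb n) (zdd_fam (inl n)).
Proof.
have nlo S : S \in zdd_fam (zdd_lo n) -> zdd_lb n \notin S.
  move=> SF; apply/negP => H.
  by have := zdd_lb_lt (n := n) (v := zdd_lo n) _ SF H; rewrite /= eqxx ltxx => /(_ isT).
have nhi S : S \in zdd_fam (zdd_hi n) -> zdd_lb n \notin S.
  move=> SF; apply/negP => H.
  by have := zdd_lb_lt (n := n) (v := zdd_hi n) _ SF H; rewrite /= eqxx orbT ltxx => /(_ isT).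
split; apply/setP=> S.
  rewrite zdd_fam_node; apply/idP/setIdP => [SF|[/setUP[//|]]].
    by rewrite in_setU SF nlo.
  by case/imsetP=> T _ ->; rewrite setU11.
apply/idP/imsetP => [SF|[T]].
  exists (zdd_lb n |: S); last by rewrite setU1K ?nhi.
  by apply/setIdP; rewrite setU11 zdd_fam_node in_setU imset_f ?orbT.
rewrite zdd_fam_node => /setIdP[/setUP[/nlo/negP//|/imsetP[V VF ->] _ ->]].
by rewrite setU1K ?nhi.
Qed.

Let zdd_top D (n : zdd_node D) :
  zdd_fam (zdd_hi n) != set0 -> top (zdd_fam (inl n)) (zdd_lb n).
Proof.
case/set0Pn=> S SF; apply/andP; split.
  apply/bigcupP; exists (zdd_lb n |: S); last by rewrite setU11.
  by rewrite zdd_fam_node in_setU imset_f ?orbT.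
by apply/forall_inP => y /bigcupP[T TF yT]; have := zdd_lb_le TF yT.
Qed.

Let reduced_n0 D : zdd_reduced D -> forall v : zdd_node D + bool,
  v <> inr false -> zdd_fam v != set0.
Proof.
case=> _ nhi; elim/zdd_ind_vertex => [[] // _|n _ IH _].
  by rewrite zdd_fam_top; apply/set0Pn; exists set0; rewrite inE.
case/set0Pn: (IH (nhi n)) => S SF; apply/set0Pn; exists (zdd_lb n |: S).
by rewrite zdd_fam_node in_setU imset_f ?orbT.
Qed.

Let zdd_step D v w : zdd_reduced D ->
  zdd_arc (@zdd_lo _ _ D) (@zdd_hi _ _ D) v w -> step (zdd_fam v) (zdd_fam w).
Proof.
move=> redD; case: v => // n H; apply/existsP; exists (zdd_lb n).
rewrite zdd_top ?reduced_n0 //=; last exact: redD.2.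
by have [<- <-] := zdd_cof n; case/orP: H => /eqP->; rewrite eqxx ?orbT.
Qed.

Let reduced_inj D : zdd_reduced D -> injective (@zdd_fam D).
Proof.
move=> redD; have n0 := reduced_n0 redD; have [mrg nhi] := redD.
have topn (n : zdd_node D) : top (zdd_fam (inl n)) (zdd_lb n).
  by apply: zdd_top; apply: n0; apply: nhi.
have cvb b : cover (zdd_fam (inr b : zdd_node D + bool)) = set0.
  apply/setP=> x; rewrite inE; apply/negP => /bigcupP[S].
  by case: b; rewrite ?zdd_fam_top ?zdd_fam_bot inE // => /eqP->; rewrite inE.
have bn b n : @zdd_fam D (inr b) <> @zdd_fam D (inl n).
  by move=> E; case/andP: (topn n); rewrite -E cvb inE.
elim/zdd_ind_vertex => [b [n /bn//|b']|n IHlo IHhi [n' E|b /esym/bn//]].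
  by case: b b' => -[] //; rewrite zdd_fam_top zdd_fam_bot => /setP/(_ set0);
    rewrite !inE eqxx.
have lbE : zdd_lb n = zdd_lb n' by apply: top_uniq (topn n) _; rewrite E; apply: topn.
have [l1 h1] := zdd_cof n; have [l2 h2] := zdd_cof n'.
by congr inl; apply: mrg => //; [apply: IHlo|apply: IHhi];
  rewrite ?l1 ?l2 ?h1 ?h2 E lbE.
Qed.

Let zdd_real D v A : @zdd_fam D v = A -> cover A != set0 ->
  exists n, zdd_fam (inl n) = A /\ zdd_fam (@zdd_hi _ _ D n) != set0.
Proof.
elim/zdd_ind_vertex: v => [b <-|n IH _ nA cA].
  case/set0Pn=> x /bigcupP[S].
  by case: b; rewrite ?zdd_fam_top ?zdd_fam_bot inE // => /eqP->; rewrite inE.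
case: (altP (zdd_fam (zdd_hi n) =P set0)) => [h0|hn]; last by exists n.
by apply: IH => //; rewrite -nA zdd_fam_node h0 imset0 setU0.
Qed.

Let zdd_reach D A B v : @zdd_fam D v = A -> connect step A B ->
  exists w, @zdd_fam D w = B.
Proof.
move=> vA /connectP[p]; elim: p A v vA => [|C p IH] A v vA /= => [_ ->|].
  by exists v.
case/andP=> /existsP[x /andP[tx HC]] pth BE.
have cA : cover A != set0 by apply/set0Pn; exists x; case/andP: tx.
have [n [nA hn]] := zdd_real vA cA.
have lbx : zdd_lb n = x by apply: top_uniq tx; rewrite -nA; apply: zdd_top.
have [lE hE] := zdd_cof n; rewrite lbx nA in lE hE.
by case/orP: HC => /eqP EC; [apply: (IH C (zdd_lo n) _ pth BE)
                            |apply: (IH C (zdd_hi n) _ pth BE)]; rewrite EC.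
Qed.

Lemma zdd_reduced_min D D' F : zdd_reduced D -> zdd_represents D F ->
  zdd_represents D' F -> (zdd_size D <= zdd_size D')%N.
Proof.
move=> redD DF DF'; rewrite /zdd_size !ltnS.
have ex n : exists n', @zdd_fam D' (inl n') == @zdd_fam D (inl n).
  have ct v w : connect (zdd_arc (@zdd_lo _ _ D) (@zdd_hi _ _ D)) v w ->
      connect step (zdd_fam v) (zdd_fam w).
    case/connectP=> p; elim: p v => [v _ ->//|u p IH v /= /andP[a pth] wE].
    exact: connect_trans (connect1 (zdd_step redD a)) (IH _ pth wE).
  have := ct _ _ (zdd_rooted n); rewrite DF -DF' => /(zdd_reach erefl)[w].
  move/zdd_real; case=> [|n' [E _]]; last by exists n'; apply/eqP.
  apply/set0Pn; exists (zdd_lb n).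
  by have /andP[] := zdd_top (reduced_n0 redD (redD.2 n)).
pose f (n : zdd_node D) : zdd_node D' := xchoose (ex n).
apply: (@leq_card _ _ f) => n1 n2 E.
suff [] : inl n1 = inl n2 :> zdd_node D + bool by [].
apply: (reduced_inj redD).
by rewrite -(eqP (xchooseP (ex n1))) -(eqP (xchooseP (ex n2))) -/(f n1) E.
Qed.

Section Existence.
Variable F : {set {set U}}.

Let N : finType := {A : {set {set U}} | connect step F A && (cover A != set0)}.

Let vtx A : N + bool := if insub A is Some a then inl a else inr (set0 \in A).

Let lb (a : N) : U := xchoose (top_ex (proj2 (andP (valP a)))).

Let lbP a : top (val a) (lb a). Proof. exact: xchooseP. Qed.

Let lo (a : N) := vtx (fam0 (lb a) (val a)).
Let hi (a : N) := vtx (fam1 (lb a) (val a)).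

Let vtx_inl A (a : N) : vtx A = inl a -> A = val a.
Proof. by rewrite /vtx; case: insubP => // b _ <- [->]. Qed.

Let vtx_val (a : N) : vtx (val a) = inl a.
Proof. by rewrite /vtx valK. Qed.

Let vtx_inr A b : connect step F A -> vtx A = inr b ->
  A = if b then [set set0] else set0.
Proof.
rewrite /vtx; case: insubP => // + FA; rewrite FA negbK => /eqP cA [<-].
by have [->|->] := cover_eq0 cA; rewrite !inE ?eqxx.
Qed.

Let vtx_inj A B : connect step F A -> connect step F B -> vtx A = vtx B -> A = B.
Proof.
move=> FA FB E; case Ev: (vtx A) => [a|b].
  by rewrite (vtx_inl Ev); rewrite Ev in E; rewrite (vtx_inl (esym E)).
by rewrite (vtx_inr FA Ev); rewrite Ev in E; rewrite (vtx_inr FB (esym E)).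
Qed.

Let ordered a a' : zdd_arc lo hi (inl a) (inl a') -> (lb a < lb a')%O.
Proof.
move=> H; have /andP[ca' _] := lbP a'; apply: lt_cof (lbP a) _ ca'.
by case/orP: H => /eqP/esym/vtx_inl <-; rewrite eqxx ?orbT.
Qed.

Let step_lo (a : N) : step (val a) (fam0 (lb a) (val a)).
Proof. by apply/existsP; exists (lb a); rewrite lbP eqxx. Qed.

Let step_hi (a : N) : step (val a) (fam1 (lb a) (val a)).
Proof. by apply/existsP; exists (lb a); rewrite lbP eqxx orbT. Qed.

Let rooted a : connect (zdd_arc lo hi) (vtx F) (inl a).
Proof.
have /andP[/connectP[p] pth laE _] := valP a.
rewrite -vtx_val laE; elim/last_ind: p pth {a laE} => // p B IH.
rewrite rcons_path last_rcons => /andP[pth stB].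
apply: connect_trans (IH pth) _; apply: connect1.
set C := last F p in stB *; case/existsP: (stB) => x /andP[tx HB].
have FC : connect step F C by apply/connectP; exists p.
have PC : connect step F C && (cover C != set0).
  by rewrite FC; apply/set0Pn; exists x; case/andP: tx.
pose c : N := exist _ C PC.
have -> : vtx C = inl c by rewrite -(vtx_val c).
have lbx : lb c = x by apply: top_uniq (lbP c) tx.
by rewrite /= /lo /hi lbx /=; case/orP: HB => /eqP->; rewrite eqxx ?orbT.
Qed.

Lemma zdd_reduced_ex : exists D : zdd U, zdd_reduced D /\ zdd_represents D F.
Proof.
pose D := Zdd ordered rooted; exists D.
have FN (a : N) : connect step F (val a) by case/andP: (valP a).
have Flo a : connect step F (fam0 (lb a) (val a)).
  exact: connect_trans (FN a) (connect1 (step_lo a)).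
have Fhi a : connect step F (fam1 (lb a) (val a)).
  exact: connect_trans (FN a) (connect1 (step_hi a)).
split.
  split=> [a a' /= El Elo Ehi|a /= Eh].
    apply: val_inj; rewrite (famE (lb a) (val a)) (famE (lb a') (val a')).
    by rewrite (vtx_inj (Flo _) (Flo _) Elo) (vtx_inj (Fhi _) (Fhi _) Ehi) El.
  have /andP[/fam1_n0 + _] := lbP a.
  by rewrite (vtx_inr (Fhi a) Eh) eqxx.
suff H : forall v A, connect step F A -> vtx A = v -> @zdd_fam D v = A.
  exact: (H _ F (connect0 _ _) erefl).
elim/(@zdd_ind_vertex D) => [b A FA /(vtx_inr FA)->|a IHlo IHhi A _ /vtx_inl->].
  by case: b; rewrite ?zdd_fam_top ?zdd_fam_bot.
by rewrite zdd_fam_node (IHlo _ (Flo a) erefl) (IHhi _ (Fhi a) erefl) -famE.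
Qed.

End Existence.

Definition reduced_zdd F : zdd U := sval (cid (zdd_reduced_ex F)).

(* The number Z_<(F), for the order < carried by U. *)
Definition zdd_nodes F : nat := zdd_size (reduced_zdd F).

Lemma reduced_zddP F :
  zdd_reduced (reduced_zdd F) /\ zdd_represents (reduced_zdd F) F.
Proof. exact: svalP (cid (zdd_reduced_ex F)). Qed.

Lemma zdd_nodes_min D F : zdd_represents D F -> (zdd_nodes F <= zdd_size D)%N.
Proof. by have [rD rF] := reduced_zddP F; apply: zdd_reduced_min. Qed.

Lemma zdd_nodes_reduced D F :
  zdd_reduced D -> zdd_represents D F -> zdd_size D = zdd_nodes F.
Proof.
move=> rD DF; apply/eqP; rewrite eqn_leq zdd_nodes_min // andbT.
by have [_ rF] := reduced_zddP F; apply: zdd_reduced_min rF.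
Qed.

End Zdd.

Definition bigO (f g : nat -> nat) : Prop :=
  exists C M : nat, forall m, (M <= m)%N -> (f m <= C * g m)%N.

(* Main.v *)
(* The ground set consists of three blocks g, x, y of equal length, in this
   order.  The dividend is the family of all S containing exactly one g_k and
   such that x_k \in S iff y_k \in S: its diagram remembers only k and one bit.
   The divisor is the family of all {g_k}, so that the quotient intersects all
   these conditions and forces the x- and y-parts of S to agree, while the
   remainder forces them to differ.  In both cases the part of S in the block x
   has to be remembered completely before the block y is read.  Sizes are
   compared as in the Myhill-Nerode theorem: the vertices of a reduced diagram
   correspond to residuals of the family by prefixes. *)

Require Import Defs.
From mathcomp Require Import reals exp.
From mathcomp Require Import all_boot all_order all_algebra.
From mathcomp Require Import boolp zify.

Set Implicit Arguments.
Unset Strict Implicit.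
Unset Printing Implicit Defensive.

Import Order.TTheory.

(** * Paths in diagrams, and a lower bound on node counts by residuals *)

Section Residuals.
Variables (d : Order.disp_t) (U : finOrderType d).
Implicit Types (D : zdd U) (H : {set {set U}}) (L P B S : {set U}) (x y : U).

Lemma arc_lo D (n : zdd_node D) :
  zdd_arc (@zdd_lo _ _ D) (@zdd_hi _ _ D) (inl n) (zdd_lo n).
Proof. by rewrite /= eqxx. Qed.

Lemma arc_hi D (n : zdd_node D) :
  zdd_arc (@zdd_lo _ _ D) (@zdd_hi _ _ D) (inl n) (zdd_hi n).
Proof. by rewrite /= eqxx orbT. Qed.

Lemma zdd_mem_lb_lt D (n : zdd_node D) (v : zdd_node D + bool) S x :
  zdd_arc (@zdd_lo _ _ D) (@zdd_hi _ _ D) (inl n) v ->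
  S \in zdd_fam v -> x \in S -> (zdd_lb n < x)%O.
Proof.
move=> nv; rewrite inE => /asboolP vS.
elim: vS n nv => [n _|n' {}S _ IH n nn'|n' {}S _ IH n nn'].
- by rewrite inE.
- by move=> /(IH _ (arc_lo n')); apply: lt_trans (zdd_ordered nn').
- case/setU1P => [->|/(IH _ (arc_hi n'))]; first exact: zdd_ordered nn'.
  exact: lt_trans (zdd_ordered nn').
Qed.

Lemma zdd_mem_lb_le D (n : zdd_node D) S x :
  S \in zdd_fam (inl n) -> x \in S -> (zdd_lb n <= x)%O.
Proof.
rewrite zdd_fam_node => /setUP[Slo xS|/imsetP[T Thi ->] /setU1P[->//|xT]].
  exact: ltW (zdd_mem_lb_lt (arc_lo n) Slo xS).
exact: ltW (zdd_mem_lb_lt (arc_hi n) Thi xT).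
Qed.

Lemma zdd_child_notin D (n : zdd_node D) (v : zdd_node D + bool) S :
  zdd_arc (@zdd_lo _ _ D) (@zdd_hi _ _ D) (inl n) v ->
  S \in zdd_fam v -> zdd_lb n \notin S.
Proof. by move=> nv vS; apply/negP => /(zdd_mem_lb_lt nv vS); rewrite ltxx. Qed.

Lemma zdd_fam_lo D (n : zdd_node D) S :
  zdd_lb n \notin S -> (S \in zdd_fam (inl n)) = (S \in zdd_fam (zdd_lo n)).
Proof.
move=> nS; rewrite zdd_fam_node; apply/setUP/idP => [[//|/imsetP[T _ ST]]|]; last by left.
by rewrite ST setU11 in nS.
Qed.

Lemma zdd_fam_hi D (n : zdd_node D) S :
  zdd_lb n \notin S ->
  (zdd_lb n |: S \in zdd_fam (inl n)) = (S \in zdd_fam (zdd_hi n)).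
Proof.
move=> nS; rewrite zdd_fam_node; apply/setUP/idP => [[lS|/imsetP[T hT E]]|hS].
- by have := zdd_child_notin (arc_lo n) lS; rewrite setU11.
- have nT := zdd_child_notin (arc_hi n) hT.
  by rewrite -(setU1K nS) E setU1K.
- by right; apply: imset_f.
Qed.

(** Follow the path of [S] from [v] while the labels lie in [L], stopping at a terminal or at the
    first label outside [L]. In the latter case the remaining elements of [S] are at least that
    label, hence outside [L] because [L] is downward closed. *)
Lemma zdd_residual D L (v : zdd_node D + bool) S :
  (forall x y, (x <= y)%O -> y \in L -> x \in L) -> zdd_mem v S ->
  exists w : zdd_node D + bool, forall B, [disjoint B & L] ->
    (B \in zdd_fam w) = (S :&: L :|: B \in zdd_fam v).
Proof.
move=> Ldown; elim=> [|n {}S lS [w IH]|n {}S hS [w IH]].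
- by exists (inr true) => B _; rewrite set0I set0U.
- have {}lS : S \in zdd_fam (zdd_lo n) by rewrite inE; apply/asboolP.
  case: (boolP (zdd_lb n \in L)) => nL.
    exists w => B BL; rewrite IH // zdd_fam_lo // !inE negb_or nL andbT.
    by rewrite (zdd_child_notin (arc_lo n) lS) /= (disjointFl BL).
  exists (inl n) => B _; rewrite (_ : S :&: L = set0) ?set0U //.
  apply/setP => x; rewrite !inE; apply: contraNF nL => /andP[xS].
  exact: Ldown (ltW (zdd_mem_lb_lt (arc_lo n) lS xS)).
- have {}hS : S \in zdd_fam (zdd_hi n) by rewrite inE; apply/asboolP.
  case: (boolP (zdd_lb n \in L)) => nL.
    exists w => B BL; rewrite IH // -zdd_fam_hi.
      by rewrite setIUl setUA (setIidPl (_ : [set _] \subset L)) ?sub1set.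
    by rewrite !inE negb_or nL andbT (zdd_child_notin (arc_hi n) hS) /= (disjointFl BL).
  exists (inl n) => B _; rewrite (_ : (_ |: S) :&: L = set0) ?set0U //.
  apply/setP => x; rewrite !inE; apply: contraNF nL => /andP[/orP[/eqP<-//|xS]].
  exact: Ldown (ltW (zdd_mem_lb_lt (arc_hi n) hS xS)).
Qed.

(** A member extending [P t] leads to a vertex that represents, on sets disjoint from [L], the
    residual of [H] by [P t]. Different residuals need different vertices. *)
Lemma zdd_nodes_ge (T : finType) (P : T -> {set U}) L H :
  (forall x y, (x <= y)%O -> y \in L -> x \in L) ->
  (forall t, P t \subset L) ->
  (forall t, exists2 B : {set U}, [disjoint B & L] & P t :|: B \in H) ->
  (forall t t', (forall B, [disjoint B & L] ->
     (P t :|: B \in H) = (P t' :|: B \in H)) -> t = t') ->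
  #|T| <= zdd_nodes H.
Proof.
move=> Ldown PL nonempty sep; rewrite /zdd_nodes.
have [_] := reduced_zddP H; move: (reduced_zdd H) => D DH.
have ex t : exists w : zdd_node D + bool,
    [forall B : {set U}, [disjoint B & L] ==> ((B \in zdd_fam w) == (P t :|: B \in H))].
  have [B BL] := nonempty t; rewrite -DH inE => /asboolP /(zdd_residual Ldown)[w wP].
  exists w; apply/forallP => C; apply/implyP => CL; apply/eqP; rewrite wP //.
  by rewrite setIUl (disjoint_setI0 BL) setU0 (setIidPl (PL t)).
have -> : zdd_size D = #|{: zdd_node D + bool}| by rewrite card_sum card_bool addn2.
apply: (@leq_card _ _ (fun t => xchoose (ex t))) => t t' tt'.
apply: sep => B BL.
have /forallP/(_ B)/implyP/(_ BL)/eqP <- := xchooseP (ex t).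
by have /forallP/(_ B)/implyP/(_ BL)/eqP <- := xchooseP (ex t'); rewrite tt'.
Qed.

(** * An upper bound on node counts by classes of prefixes *)

Lemma zdd_vertex_ind D (P : zdd_node D + bool -> Prop) :
  (forall b, P (inr b)) ->
  (forall n, P (zdd_lo n) -> P (zdd_hi n) -> P (inl n)) -> forall v, P v.
Proof.
move=> Pb Pn [n|//].
(* The number of elements above the label decreases strictly along arcs. *)
have [k] := ubnP #|[set y | (zdd_lb n < y)%O]|.
elim: k n => // k IH n; rewrite ltnS => nk.
suff Pc w : zdd_arc (@zdd_lo _ _ D) (@zdd_hi _ _ D) (inl n) w -> P w.
  by apply: Pn; apply: Pc; [apply: arc_lo | apply: arc_hi].
case: w => // n' /zdd_ordered ltn; apply: IH; apply: leq_trans nk.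
apply/proper_card/properP; split; last by exists (zdd_lb n'); rewrite !inE ?ltxx.
by apply/subsetP=> y; rewrite !inE; apply: lt_trans.
Qed.

(** A [hi] arc never enters ⊥, so following [hi] arcs ends in ⊤ and spells out a member that
    contains the label. *)
Lemma zdd_reduced_witness D : zdd_reduced D -> forall n : zdd_node D,
  exists S, zdd_lb n |: S \in zdd_fam (inl n).
Proof.
case=> _ nbot n.
suff [S hS] : exists S, S \in zdd_fam (zdd_hi n).
  by exists S; rewrite zdd_fam_hi // (zdd_child_notin (arc_hi n)).
elim/zdd_vertex_ind: (zdd_hi n) (nbot n) => [[//|//] _|n' _ IH _].
  by exists set0; rewrite zdd_fam_top set11.
have [S hS] := IH (nbot n'); exists (zdd_lb n' |: S).
by rewrite zdd_fam_hi // (zdd_child_notin (arc_hi n')).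
Qed.

(** The family determines the label, as the least element occurring in its members, and then the
    families of both children. Induction and the merging rule do the rest. *)
Lemma zdd_reduced_inj D : zdd_reduced D -> injective (@zdd_fam _ _ D).
Proof.
move=> redD; have wit := zdd_reduced_witness redD.
have not_const b (n : zdd_node D) : zdd_fam (inr b) <> zdd_fam (inl n).
  have [S nS] := wit n => E; move: nS; rewrite -E.
  case: b {E}; rewrite ?zdd_fam_top ?zdd_fam_bot inE // => /eqP/setP/(_ (zdd_lb n)).
  by rewrite !inE eqxx.
have lb_le (n n' : zdd_node D) : zdd_fam (inl n) = zdd_fam (inl n') ->
    (zdd_lb n' <= zdd_lb n)%O.
  by move=> E; have [S] := wit n; rewrite E => /zdd_mem_lb_le; apply; rewrite setU11.
elim/zdd_vertex_ind => [b [n /not_const//|b']|n IHlo IHhi [n' E|b /esym/not_const//]].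
  by case: b b' => -[] //; rewrite zdd_fam_top zdd_fam_bot => /setP/(_ set0);
    rewrite !inE eqxx.
have lbE : zdd_lb n = zdd_lb n' by apply: le_anti; rewrite !lb_le.
congr inl; apply: redD.1 => //.
  apply: IHlo; apply/setP => S; have [nS|nS] := boolP (zdd_lb n \in S).
    by rewrite !(contraTF (zdd_child_notin (arc_lo _))) ?negbK // -lbE.
  by rewrite -!zdd_fam_lo -?lbE ?E.
apply: IHhi; apply/setP => S; have [nS|nS] := boolP (zdd_lb n \in S).
  by rewrite !(contraTF (zdd_child_notin (arc_hi _))) ?negbK // -lbE.
by rewrite -!zdd_fam_hi -?lbE ?E // lbE.
Qed.

(** [P] collects the labels that some path from the root to [n] leaves by [hi] arcs. The labels met
    before [n] are smaller than all elements of [B], so [B] does not interfere with the choices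
    along the path. *)
Lemma zdd_prefix D (n : zdd_node D) :
  exists2 P : {set U}, forall y, y \in P -> (y < zdd_lb n)%O &
  forall B, (forall y, y \in B -> (zdd_lb n <= y)%O) ->
    (B \in zdd_fam (inl n)) = (P :|: B \in zdd_fam (zdd_root D)).
Proof.
have /connectP[p] := zdd_rooted n.
elim/last_ind: p n => [|p v IH] n /=.
  move=> _ <-; exists set0 => [y|B _]; first by rewrite inE.
  by rewrite set0U.
rewrite rcons_path last_rcons => /andP[pth av] nv; move: av; rewrite -{v}nv.
case E: (last _ p) => [u|//] un; have [P Plt PB] := IH u pth (esym E).
have un_lt := zdd_ordered un.
have unB B : (forall y, y \in B -> (zdd_lb n <= y)%O) -> zdd_lb u \notin B.
  by move=> Bge; apply/negP => /Bge; rewrite leNgt un_lt.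
case/orP: (un) => /eqP nE.
  exists P => [y /Plt yu|B Bge]; first exact: lt_trans un_lt.
  rewrite nE -zdd_fam_lo ?unB // PB // => y /Bge; apply: le_trans; exact: ltW.
exists (zdd_lb u |: P) => [y /setU1P[->//|/Plt yu]|B Bge]; first exact: lt_trans un_lt.
rewrite nE -zdd_fam_hi ?unB // PB; first by rewrite setUCA setUA.
by move=> y /setU1P[->//|/Bge]; apply: le_trans; exact: ltW.
Qed.

(** [cls] acts as the state of an automaton reading the elements in order. Nodes with equal label
    and equal state have equal residuals, so they coincide in a reduced diagram. The final 2 counts
    the terminals. *)
Lemma zdd_nodes_le (Q : finType) (cls : {set U} -> Q) H :
  (forall x P P' B, (forall y, y \in P -> (y < x)%O) ->
     (forall y, y \in P' -> (y < x)%O) -> (forall y, y \in B -> (x <= y)%O) ->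
     cls P = cls P' -> P :|: B \in H -> P' :|: B \in H) ->
  zdd_nodes H <= (#|U| * #|Q|).+2.
Proof.
move=> clsP; rewrite /zdd_nodes.
have [redD] := reduced_zddP H; move: (reduced_zdd H) redD => D redD DH.
rewrite /zdd_size !ltnS -card_prod.
have prefix := @zdd_prefix D; rewrite DH in prefix.
have ex n := cid2 (prefix n).
pose pre n := s2val (ex n).
apply: (@leq_card _ _ (fun n => (zdd_lb n, cls (pre n)))) => n n' [lbE clsE].
suff [//] : inl n = inl n' :> zdd_node D + bool.
have sub (a b : zdd_node D) B : zdd_lb a = zdd_lb b -> cls (pre a) = cls (pre b) ->
    B \in zdd_fam (inl a) -> B \in zdd_fam (inl b).
  move=> abE cE aB.
  have Bge y : y \in B -> (zdd_lb a <= y)%O by apply: zdd_mem_lb_le aB.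
  rewrite (s2valP' (ex b)); last by rewrite -abE.
  rewrite (s2valP' (ex a)) // in aB.
  apply: clsP (s2valP (ex a)) _ Bge cE aB.
  by rewrite abE; apply: (s2valP (ex b)).
by apply: zdd_reduced_inj => //; apply/setP => B; apply/idP/idP; apply: sub.
Qed.

End Residuals.


(** * The example, its quotient and its remainder *)

Section Witness.
Variable m : nat.
(** At least two indices are needed for the remainder: [ord0] to agree at and [ord_max] to differ
    at. *)
Local Notation I := 'I_m.+2.
Local Notation U := ('I_3 *l I)%type.
Implicit Types (S T P : {set U}) (A B C : {set I}) (s : 'I_3) (k : I).

(* The trace of [S] on the block [s] (0, 1, 2 for g, x, y). *)
Definition sec s S : {set I} := [set k | (s, k) \in S].

Definition tri C A1 A2 : {set U} :=
  [set u : U | u.2 \in (if u.1 == 0 :> nat then C else if u.1 == 1 :> nat then A1 else A2)].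

Local Notation "0" := (Ordinal (isT : 0 < 3)).
Local Notation "1" := (Ordinal (isT : 1 < 3)).
Local Notation "2" := (Ordinal (isT : 2 < 3)).

Definition sel_eq : {set {set U}} :=
  [set S | [exists k, (sec 0 S == [set k]) && ((k \in sec 1 S) == (k \in sec 2 S))]].

Definition selectors : {set {set U}} := [set [set ((0, k) : U)] | k : I].

Lemma secU s S T : sec s (S :|: T) = sec s S :|: sec s T.
Proof. by apply/setP => k; rewrite !inE. Qed.

Lemma sec_set1 s s' k : sec s [set ((s', k) : U)] = if s == s' then [set k] else set0.
Proof.
apply/setP => j; rewrite inE in_set1 xpair_eqE.
by case: eqP => //=; rewrite inE.
Qed.

Lemma sec_tri C A1 A2 : (sec 0 (tri C A1 A2) = C) * (sec 1 (tri C A1 A2) = A1)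
  * (sec 2 (tri C A1 A2) = A2).
Proof. by do 2?split; apply/setP => k; rewrite !inE. Qed.

Lemma triU C A1 A2 : tri C A1 A2 = tri C A1 set0 :|: tri set0 set0 A2.
Proof.
apply/setP => -[s k]; rewrite !inE /=; do 2?case: ifP => _; by rewrite !inE ?orbF.
Qed.

(** Disjointness from all selectors empties the g-part. Adding g_k then tests agreement at [k]
    alone, and [k] is arbitrary. *)
Lemma fam_quoE S :
  (S \in fam_quo sel_eq selectors) = (sec 0 S == set0) && (sec 1 S == sec 2 S).
Proof.
have addE k : sec 0 S = set0 ->
    (S :|: [set ((0, k) : U)] \in sel_eq) = ((k \in sec 1 S) == (k \in sec 2 S)).
  move=> S0; rewrite inE !secU !sec_set1 S0 /= !setU0 set0U.
  apply/existsP/eqP => [[j /andP[/eqP/set1_inj <- /eqP]]//|kS].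
  by exists k; rewrite eqxx kS /=.
rewrite inE; apply/forall_inP/andP => [SF|[/eqP S0 /eqP S12] _ /imsetP[k _ ->]].
  have S0 : sec 0 S = set0.
    apply/setP => k; rewrite !inE; apply/negP => kS.
    have /SF/andP[_ /eqP/setP/(_ (0, k))] : [set ((0, k) : U)] \in selectors by apply: imset_f.
    by rewrite !inE kS eqxx.
  split; first by rewrite S0.
  apply/eqP/setP => k.
  have /SF/andP[+ _] : [set ((0, k) : U)] \in selectors by apply: imset_f.
  by rewrite addE // => /eqP.
rewrite addE // S12 eqxx setIC /=.
apply/eqP/setP => u; rewrite !inE; apply/negP => /andP[/eqP-> kS].
by have := in_set0 k; rewrite -S0 inE kS.
Qed.

(** A selector does not touch the blocks x and y, so every set in the join has equal x- and y-parts.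
    Conversely, such a member of [sel_eq] splits into its g_k and a set of the quotient. *)
Lemma fam_remE S :
  (S \in fam_rem sel_eq selectors) = (S \in sel_eq) && (sec 1 S != sec 2 S).
Proof.
rewrite in_setD andbC; case: (boolP (S \in sel_eq)) => //= SF; congr (~~ _).
apply/imset2P/idP => [[_ T /imsetP[k _ ->]]|S12].
  rewrite fam_quoE => /andP[_ /eqP T12] ->.
  by rewrite !secU !sec_set1 T12.
move: SF; rewrite inE => /existsP[k /andP[/eqP S0 _]].
have kS : (0, k) \in S by have := set11 k; rewrite -S0 inE.
exists [set (0, k)] (S :\ (0, k)); [exact: imset_f| |by rewrite setD1K].
rewrite fam_quoE; apply/andP; split.
  by apply/eqP/setP => j; have := in_set1 j k; rewrite -S0 !inE xpair_eqE /= => ->; rewrite andNb.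
apply/eqP/setP => j; have /setP/(_ j) := eqP S12.
by rewrite !inE !xpair_eqE /=.
Qed.

(** * Exponential lower bound for both operations *)

Lemma lexi_fst_le (u v : U) : (u <= v)%O -> u.1 <= v.1.
Proof. by case: u v => [s k] [t j]; rewrite lexi_pair => /andP[]. Qed.

(** The cut [L] lies between the blocks x and y. With the g-part fixed to [C], the x-parts [A] are
    the prefixes and the y-parts [B] the suffixes. *)
Lemma zdd_nodes_tri (H : {set {set U}}) C :
  (forall A, exists B, tri C A B \in H) ->
  (forall A A', (forall B, (tri C A B \in H) = (tri C A' B \in H)) -> A = A') ->
  2 ^ m <= zdd_nodes H.
Proof.
move=> nonempty sep; pose L := [set u : U | u.1 < 2].
have disj B : [disjoint tri set0 set0 B & L].
  rewrite -setI_eq0; apply/eqP/setP => -[[[|[|s]] ?] k]; rewrite !inE /= ?inE //.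
  by rewrite andbF.
apply: (@leq_trans #|{set I}|).
  by rewrite -cardsT -powersetT card_powerset cardsT card_ord leq_exp2l // -addn2 leq_addr.
apply: (@zdd_nodes_ge _ _ _ (fun A => tri C A set0) L).
- by move=> u v /lexi_fst_le uv; rewrite !inE; apply: leq_ltn_trans.
- move=> A; apply/subsetP => -[s k]; rewrite !inE /=.
  by case: s => [[|[|s]]] //=; rewrite inE.
- by move=> A; have [B AB] := nonempty A; exists (tri set0 set0 B); rewrite -?triU.
- move=> A A' AA'; apply: sep => B; rewrite triU [in RHS]triU; exact: AA'.
Qed.

Lemma zdd_nodes_op op : 2 ^ m <= zdd_nodes (fam_op_fun op sel_eq selectors).
Proof.
case: op => /=.
  apply: (@zdd_nodes_tri _ set0) => [A|A A' AA'].
    by exists A; rewrite fam_quoE !sec_tri !eqxx.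
  by have := AA' A; rewrite !fam_quoE !sec_tri !eqxx /= => /esym/eqP.
(* A block y agreeing with [A] at [ord0] but different from [A] keeps the
   residual nonempty. *)
pose flip A : {set I} := [set k | (k \in A) (+) (k == ord_max)].
have flipF A : A != flip A.
  by apply/eqP => /setP/(_ ord_max); rewrite inE eqxx addbT; case: (_ \in _).
have remE A B : (tri [set ord0] A B \in fam_rem sel_eq selectors) =
    ((ord0 \in A) == (ord0 \in B)) && (A != B).
  rewrite fam_remE inE !sec_tri; congr (_ && _).
  apply/existsP/idP => [[k /andP[/eqP/set1_inj<-//]]|AB].
  by exists ord0; rewrite eqxx AB.
have flip0 A : (ord0 \in flip A) = (ord0 \in A) by rewrite inE addbF.
apply: (@zdd_nodes_tri _ [set ord0]) => [A|A A' AA'].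
  by exists (flip A); rewrite remE flip0 eqxx flipF.
(* Since [flip A] lies in the residual of [A], it lies in that of [A'], so [A] and [A'] agree at
   [ord0]. As [A] is missing from its own residual, it is missing from that of [A'], which now
   forces equality. *)
have := AA' (flip A); rewrite !remE flip0 eqxx flipF /= => /esym/andP[/eqP A0 _].
by have := AA' A; rewrite !remE A0 !eqxx /= => /esym/negbFE/eqP.
Qed.

(** * Polynomial size of the operands *)

Lemma zdd_nodes_sel_eq : zdd_nodes sel_eq <= (3 * m.+2 * (m.+2 * 4).+2).+2.
Proof.
(* [None] means that no g_k has been read, and [Some None] is the dead state after several.
   Otherwise [k] is kept with the bits for x_k and y_k. *)
pose cls P : option (option (I * (bool * bool))) :=
  if sec 0 P == set0 then None else
  Some (omap (fun k => (k, (k \in sec 1 P, k \in sec 2 P))) [pick k | sec 0 P == [set k]]).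
have -> : 3 * m.+2 = #|{: U}| by rewrite card_prod !card_ord.
have -> : (m.+2 * 4).+2 = #|{: option (option (I * (bool * bool)))}|.
  by rewrite !card_option !card_prod !card_bool card_ord.
apply: (zdd_nodes_le (cls := cls)) => x P P' B Plt P'lt Bge.
rewrite /cls inE => clsE /existsP[k].
rewrite !secU => /andP[/eqP k0 k12]; move: clsE.
have [P0|P0] := eqVneq (sec 0 P) set0; have [P'0|P'0] := eqVneq (sec 0 P') set0 => //.
  (* The missing g_k is still to come in [B], so both prefixes end within the block g. Their g-parts
     being empty, they are empty. *)
  have Bk : (0, k) \in B by have := set11 k; rewrite -k0 P0 set0U inE.
  have empty T : (forall u, u \in T -> (u < x)%O) -> sec 0 T = set0 -> T = set0.
    move=> Tlt T0; apply/setP => -[s j]; rewrite !inE; apply/negP => Tsj.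
    have := lexi_fst_le (ltW (lt_le_trans (Tlt _ Tsj) (Bge _ Bk))).
    rewrite /= leqn0 => /eqP s0; have := in_set0 j; rewrite -T0 inE.
    by rewrite (_ : 0 = s) ?Tsj //; apply/val_inj.
  rewrite (empty _ Plt P0) in k0 k12; rewrite (empty _ P'lt P'0) => _.
  by rewrite inE; apply/existsP; exists k; rewrite !secU k0 eqxx k12.
have Pk : sec 0 P = [set k].
  by apply/eqP; move: (subsetUl (sec 0 P) (sec 0 B)); rewrite k0 subset1 (negbTE P0) orbF.
case: pickP => [i|/(_ k)]; last by rewrite Pk eqxx.
rewrite {1}Pk => /eqP/set1_inj <-; case: pickP => //= j /eqP P'k [jk b1 b2].
rewrite -jk in P'k b1 b2; rewrite inE; apply/existsP; exists k.
move: k0 k12; rewrite !secU Pk P'k => -> k12; rewrite eqxx /=.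
by move: k12; rewrite !in_setU b1 b2.
Qed.

(** A nonempty prefix of a selector is already the whole selector, so two bits describe the
    state. *)
Lemma zdd_nodes_selectors : zdd_nodes selectors <= (3 * m.+2 * 4).+2.
Proof.
have -> : 3 * m.+2 = #|{: U}| by rewrite card_prod !card_ord.
have -> : 4 = #|{: bool * bool}| by rewrite card_prod card_bool.
apply: (zdd_nodes_le (cls := fun P => (P == set0, P \in selectors))).
move=> x P P' B Plt P'lt Bge [P0E PselE] PB.
have [P0|P0] := eqVneq P set0.
  by move: PB; rewrite P0 eqxx in P0E *; rewrite (eqP (esym P0E)).
have [k _ Ek] := imsetP PB.
have Pk : P = [set (0, k)].
  by apply/eqP; move: (subsetUl P B); rewrite Ek subset1 (negbTE P0) orbF.
have B0 : B = set0.
  apply/setP => u; rewrite inE; apply/negP => uB.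
  have uP : u \in P by rewrite Pk -Ek inE uB orbT.
  by have := lt_le_trans (Plt _ uP) (Bge _ uB); rewrite ltxx.
by move: PB; rewrite B0 !setU0 PselE.
Qed.

End Witness.

(** * The asymptotic statement *)

Import GRing.Theory Num.Theory.
Local Open Scope ring_scope.

Theorem theorem9 (R : realType) (op : fam_op) :
  exists (d : Order.disp_t) (U : nat -> finOrderType d)
         (F G : forall m : nat, {set {set U m}}),
    [/\ bigO (fun m => #|U m|) (fun m => m),
        bigO (fun m => (zdd_nodes (F m) + zdd_nodes (G m))%N)
             (fun m => (m ^ 3)%N)
      & exists (p : {poly R}) (M : nat), forall m : nat, (M <= m)%N ->
          0 < p.[m%:R] /\
          2 `^ (m%:R / 5) / p.[m%:R]
            <= (zdd_nodes (fam_op_fun op (F m) (G m)))%:R].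
Proof.
exists _, (fun m => 'I_3 *l 'I_m.+2)%type, sel_eq, selectors; split.
- by exists 9%N, 1%N => m m1; rewrite card_prod !card_ord; lia.
(* The two bounds add up to a quadratic in [m] with value 166 at [m = 1], so 1000 is generous. *)
- exists 1000%N, 1%N => m m1.
  by apply: leq_trans (leq_add (zdd_nodes_sel_eq m) (zdd_nodes_selectors m)) _; nia.
(* The lower bound [2 ^ m] already dominates, so the constant polynomial 1 suffices. *)
- exists 1%R, 0%N => m _; rewrite hornerC; split; first exact: ltr01.
  rewrite divr1; apply: (@le_trans _ _ ((2 ^ m)%N%:R)).
    rewrite natrX -powR_mulrn // ler_powR // ?ler1n //.
    by rewrite ler_pdivrMr // ler_peMr // ler1n.
  by rewrite ler_nat zdd_nodes_op.
Qed.
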